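(* Assume the standing assumptions in the context, and let $f\in AC([T,x_0))$. Then $$\Big(\frac{f(x)}{\phi_2(x)}\Big)'=\Big(\frac{\phi_1(x)}{\phi_2(x)}\Big)'f_1^*(x)$$ at every $x\in I$ where $f$ is differentiable. (I) For a real number $a_1$ the following are equivalent: (i) $\lim_{x\to x_0}f_1^*(x)=a_1$; (ii) $\big(f(x)/\phi_2(x)\big)'=a_1\big(\phi_1(x)/\phi_2(x)\big)'+o\big((\phi_1(x)/\phi_2(x))'\big)$ as $x\to x_0$; (iii) as $x\to x_0$ both $f(x)=a_1\phi_1(x)+o(\phi_1(x))$ and $\big(f(x)/\phi_2(x)\big)'=a_1\big(\phi_1(x)/\phi_2(x)\big)'+o\big((\phi_1(x)/\phi_2(x))'\big)$. (II) For a real number $a_1$, the pair of conditions $$\lim_{x\to x_0}f_1^*(x)=a_1,\qquad \int_T^{x_0}\Big(\frac{\phi_1(t)}{\phi_2(t)}\Big)'[f_1^*(t)-a_1]\,dt\ \text{ convergent}$$ holds if and only if there is a real number $a_2$ such that, as $x\to x_0$, $$f(x)=a_1\phi_1(x)+a_2\phi_2(x)+o(\phi_2(x)),\qquad \Big(\frac{f(x)}{\phi_2(x)}\Big)'=a_1\Big(\frac{\phi_1(x)}{\phi_2(x)}\Big)'+o\Big(\Big(\frac{\phi_1(x)}{\phi_2(x)}\Big)'\Big).$$ In this case $$f(x)=a_1\phi_1(x)+a_2\phi_2(x)-\phi_2(x)\int_x^{x_0}\Big(\frac{\phi_1(t)}{\phi_2(t)}\Big)'[f_1^*(t)-a_1]\,dt,\qquad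 x\in[T,x_0).$$
   Context: Let $x_0\in\mathbb{R}\cup\{+\infty\}$, $T\in\mathbb{R}$ with $T<x_0$, and $I:=[T,x_0)$. All limits and asymptotic relations ''as $x\to x_0$'' are taken for $x\in I$; for functions defined only almost everywhere, over the points where they are defined. For differentiable $g,h$ put $W(g,h;x):=g(x)h'(x)-g'(x)h(x)$. Standing assumptions: $\phi_1,\phi_2\in C^1(I)$; $\phi_2(x)=o(\phi_1(x))$ as $x\to x_0$; $\phi_1(x)\ne0$, $\phi_2(x)\ne0$ for all $x\in I$; $W(x):=W(\phi_1,\phi_2;x)\ne0$ for all $x\in I$. $AC([T,x_0))$ denotes functions absolutely continuous on every compact subinterval of $I$. For such $f$ and every $t\in I$ where $f$ is differentiable define $f_1^*(t):=W(f,\phi_2;t)/W(t)$. *)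

(* Defs.v *)
From HB Require Import structures.
From mathcomp Require Import all_boot all_order all_algebra.
From mathcomp Require Import all_classical all_reals all_analysis.
Set Implicit Arguments. Unset Strict Implicit. Unset Printing Implicit Defensive.
Import Order.TTheory GRing.Theory Num.Theory.
Import numFieldNormedType.Exports.
Local Open Scope classical_set_scope.
Local Open Scope ring_scope.

Section Defs.
Variable R : realType.

Definition Iset (T : R) (x0 : \bar R) : set R :=
  [set x | T <= x /\ (x%:E < x0)%E].

(* The filter "x -> x0, x in I": left neighbourhoods of x0 if x0 is finite,
   +oo if x0 = +oo (the case x0 = -oo is excluded by T < x0). *)
Definition at_x0 (x0 : \bar R) : set_system R :=
  match x0 with
  | EFin r => r^'-
  | _ => pinfty_nbhs R
  end.

Definition dquot (f : R -> R) (x : R) : R -> R := fun y => (f y - f x) / (y - x).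

(* f has derivative d at x relative to I (one-sided at the endpoint T). *)
Definition derivI (T : R) (x0 : \bar R) (f : R -> R) (x d : R) : Prop :=
  dquot f x @ within (Iset T x0) (x^') --> d.

Definition derivableI (T : R) (x0 : \bar R) (f : R -> R) (x : R) : Prop :=
  exists d, derivI T x0 f x d.

(* The derivative relative to I (meaningful where derivableI holds). *)
Definition dI (T : R) (x0 : \bar R) (f : R -> R) (x : R) : R :=
  lim (dquot f x @ within (Iset T x0) (x^')).

Definition C1I (T : R) (x0 : \bar R) (f : R -> R) : Prop :=
  (forall x, Iset T x0 x -> derivableI T x0 f x) /\
  {within Iset T x0, continuous (dI T x0 f)}.

Definition ACI (T : R) (x0 : \bar R) (f : R -> R) : Prop :=
  forall a b, Iset T x0 a -> Iset T x0 b -> a <= b ->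
  forall eps, 0 < eps -> exists2 delta, 0 < delta &
    forall (n : nat) (u v : nat -> R),
      (forall k, (k < n)%N -> a <= u k /\ u k <= v k /\ v k <= b) ->
      (forall i j, (i < n)%N -> (j < n)%N -> i <> j -> v i <= u j \/ v j <= u i) ->
      \sum_(k < n) (v k - u k) < delta ->
      \sum_(k < n) `|f (v k) - f (u k)| < eps.

Definition Wr (T : R) (x0 : \bar R) (g h : R -> R) (x : R) : R :=
  g x * dI T x0 h x - dI T x0 g x * h x.

Definition f1star (T : R) (x0 : \bar R) (phi1 phi2 f : R -> R) (t : R) : R :=
  Wr T x0 f phi2 t / Wr T x0 phi1 phi2 t.

Definition littleo_at (F : set_system R) (u v : R -> R) : Prop :=
  forall eps : R, 0 < eps -> \forall x \near F, `|u x| <= eps * `|v x|.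

(* u = o(v) along F, over the points x where D x holds (u defined there). *)
Definition littleo_on (F : set_system R) (D : R -> Prop) (u v : R -> R) : Prop :=
  forall eps : R, 0 < eps -> \forall x \near F, D x -> `|u x| <= eps * `|v x|.

Definition lim_on (F : set_system R) (D : R -> Prop) (u : R -> R) (a : R) : Prop :=
  forall eps : R, 0 < eps -> \forall x \near F, D x -> `|u x - a| < eps.

Definition improper_conv (T : R) (x0 : \bar R) (g : R -> R) : Prop :=
  (forall x, Iset T x0 x -> lebesgue_measure.-integrable `[T, x] (EFin \o g)) /\
  exists l : R, (fun x => Rintegral lebesgue_measure `[T, x] g) @ at_x0 x0 --> l.

Definition tail_integral (x0 : \bar R) (g : R -> R) (x J : R) : Prop :=
  (fun y => Rintegral lebesgue_measure `[x, y] g) @ at_x0 x0 --> J.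

End Defs.

(* Main.v *)
Require Import Defs.
From HB Require Import structures.
From mathcomp Require Import all_boot all_order all_algebra.
From mathcomp Require Import all_classical all_reals all_analysis.
From mathcomp Require Import ring lra unstable measurable_realfun.
Import Order.TTheory GRing.Theory Num.Theory.
Import numFieldNormedType.Exports.
Set Implicit Arguments. Unset Strict Implicit. Unset Printing Implicit Defensive.
Local Open Scope classical_set_scope.
Local Open Scope ring_scope.

(* Put [q = phi1 / phi2] and [F = f / phi2 - a1 q].  The quotient rule gives
   [F' = q' (f_1^* - a1)] wherever [f] is differentiable, and [q' = - W / phi2^2]
   vanishes nowhere, hence has a constant sign, while [|q|] tends to infinity
   because [phi2 = o(phi1)].  Since [F] is absolutely continuous, a bound
   [|f_1^* - a1| <= e] on [[c, x0)] integrates to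
   [|F x - F c| <= e |q x - q c|], so [F = o(q)], which is part (I).  Part (II)
   is the fundamental theorem of calculus for [F]: the integral of
   [q' (f_1^* - a1)] over [[T, x]] is [F x - F T], so it converges iff [F] has a
   finite limit [a2], i.e. iff [f = a1 phi1 + a2 phi2 + o(phi2)].

   The fundamental theorem of calculus for an absolutely continuous [f] comes
   from writing [f] as the difference of the nondecreasing functions [V] and
   [V - f], [V] the total variation: both are absolutely continuous, so their
   Lebesgue-Stieltjes measures have Radon-Nikodym densities, and Lebesgue's
   differentiation theorem identifies the densities with the derivatives. *)

(** * Absolute continuity on a segment *)

(** This is the inner clause of [ACI] for one segment, so a hypothesis [ACI T x0 f] applied to two
    points of the interval has this type directly. *)
Definition abs_cont {R : realType} (a b : R) (f : R -> R) : Prop :=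
  forall eps, 0 < eps -> exists2 delta, 0 < delta &
    forall (n : nat) (u v : nat -> R),
      (forall k, (k < n)%N -> a <= u k /\ u k <= v k /\ v k <= b) ->
      (forall i j, (i < n)%N -> (j < n)%N -> i <> j -> v i <= u j \/ v j <= u i) ->
      \sum_(k < n) (v k - u k) < delta ->
      \sum_(k < n) `|f (v k) - f (u k)| < eps.

Section AbsCont.
Context {R : realType}.
Implicit Types (a b c d : R) (f g : R -> R).

Lemma abs_cont_uniform a b f : abs_cont a b f ->
  forall e, 0 < e -> exists2 delta, 0 < delta &
    forall x y, a <= x -> x <= y -> y <= b -> y - x < delta -> `|f y - f x| < e.
Proof.
move=> acf e e0; have [delta d0 H] := acf e e0; exists delta => // x y ax xy yb yx.
have := H 1%N (fun=> x) (fun=> y); rewrite !big_ord1; apply => //.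
by move=> [|i] [|j].
Qed.

Definition nonoverlap (p q : R * R) := (p.2 <= q.1) || (q.2 <= p.1).

(** Lists replace indexed families here because partitions are lists and refinements of them are
    obtained by concatenation. *)
Lemma abs_cont_seq a b f : abs_cont a b f ->
  forall e, 0 < e -> exists2 delta, 0 < delta &
    forall s : seq (R * R),
      {in s, forall p, [/\ a <= p.1, p.1 <= p.2 & p.2 <= b]} ->
      pairwise nonoverlap s -> \sum_(p <- s) (p.2 - p.1) < delta ->
      \sum_(p <- s) `|f p.2 - f p.1| < e.
Proof.
move=> acf e e0; have [delta d0 H] := acf e e0; exists delta => // s sab dis.
rewrite !(big_nth (0, 0)) !big_mkord => sd.
apply: (H (size s) (fun k => (nth (0, 0) s k).1) (fun k => (nth (0, 0) s k).2)) => //.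
  by move=> k ks; have [] := sab _ (mem_nth (0, 0) ks).
move=> i j si sj /eqP ij; have /(pairwiseP (0, 0)) P := dis.
(* [pairwise] only compares an entry with later ones; the conclusion is symmetric in [i] and [j]. *)
wlog lij : i j si sj ij / (i < j)%N.
  by move=> W; have [l|l|E] := ltngtP i j;
    [exact: W|rewrite or_comm; apply: W => //; rewrite eq_sym|rewrite E eqxx in ij].
by have := P i j si sj lij; rewrite /nonoverlap => /orP.
Qed.

Lemma pairmap_path x (l : seq R) : path <%R x l ->
  {in pairmap pair x l, forall p, [/\ x <= p.1, p.1 <= p.2 & p.2 <= last x l]} /\
  pairwise nonoverlap (pairmap pair x l).
Proof.
elim: l x => [//|y l IH] x /= /andP[xy yl].
have [IH1 IH2] := IH y yl; have ylast : y <= last y l.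
  exact: path_lt_le_last.
split=> [p|].
  rewrite inE => /predU1P[->|/IH1[yp pp pl]]; split => //=; first exact: ltW.
  exact: (le_trans (ltW xy)).
rewrite IH2 andbT; apply/allP => p /IH1[yp _ _].
by rewrite /nonoverlap/= yp.
Qed.

Lemma variation_pairmap a b f (l : seq R) :
  variation a b f l = \sum_(p <- pairmap pair a l) `|f p.2 - f p.1|.
Proof.
rewrite (big_nth (a, a)) size_pairmap /variation.
apply: eq_big_nat => i /andP[_ il]; rewrite (nth_pairmap a)//=.
by rewrite (set_nth_default a)// (set_nth_default a b)//= ltnW.
Qed.

Lemma sum_pairmap a (l : seq R) :
  \sum_(p <- pairmap pair a l) (p.2 - p.1) = last a l - a.
Proof.
elim: l a => [|y l IH] a /=; first by rewrite big_nil subrr.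
by rewrite big_cons IH /= addrC subrKA.
Qed.

(** Any partition of [[x, y]] is a nonoverlapping family of total length [y - x], so the [delta]
    that belongs to 1 bounds every variation sum, hence their supremum. *)
Lemma abs_cont_TV_le1 a b f : abs_cont a b f -> exists2 delta, 0 < delta &
  forall x y, a <= x -> x <= y -> y <= b -> y - x < delta ->
    (total_variation x y f <= 1)%E.
Proof.
move=> acf; have [delta d0 H] := abs_cont_seq acf ltr01; exists delta => //.
move=> x y ax xy yb yx; apply: ge_ereal_sup => _ [_ [l [xl /eqP ly] <-] <-].
rewrite lee_fin variation_pairmap ltW//.
have [P1 P2] := pairmap_path xl; apply: H => //; last by rewrite sum_pairmap ly.
move=> p /P1[xp pp pl]; split => //; first exact: le_trans xp.
by rewrite (le_trans pl)// ly.
Qed.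

(** The segment is cut into finitely many pieces shorter than [delta]; each has variation at most 1,
    and total variation is additive. *)
Lemma abs_cont_bounded_variation a b f : a <= b -> abs_cont a b f ->
  bounded_variation a b f.
Proof.
move=> ab acf; have [delta d0 H] := abs_cont_TV_le1 acf.
(* Truncating at [b] makes the grid reach [b] exactly and stay there, so one induction on [n] covers
   the segment. *)
pose x n := Num.min b (a + n%:R * (delta / 2)).
have xb n : x n <= b by rewrite /x ge_min lexx.
have ax n : a <= x n by rewrite /x le_min ab/= lerDl mulr_ge0// divr_ge0// ltW.
have xS n : x n <= x n.+1 /\ x n.+1 - x n < delta.
  have E : n.+1%:R * (delta / 2) = n%:R * (delta / 2) + delta / 2 :> R.
    by rewrite -natr1 mulrDl mul1r.
  rewrite /x E; set z := a + _; rewrite addrA -/z /Num.min.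
  by case: ltP => h1; case: ltP => h2; split; lra.
have fin n : total_variation a (x n) f \is a fin_num.
  elim: n => [|n IH].
    by rewrite /x mul0r addr0 min_r// total_variationxx.
  have [xn xd] := xS n.
  rewrite (total_variationD f (ax n) xn) fin_numD IH/=.
  rewrite ge0_fin_numE ?total_variation_ge0//.
  by rewrite (le_lt_trans (H _ _ _ _ _ _))// ltry.
apply/bounded_variationP => //; have <- : x (Num.bound ((b - a) / (delta / 2))) = b.
  rewrite /x min_l// -lerBlDl -ler_pdivrMr ?divr_gt0// ltW// archi_boundP//.
  by rewrite divr_ge0 ?subr_ge0// divr_ge0// ltW.
exact: fin.
Qed.

Lemma abs_cont_bounded a b f : abs_cont a b f ->
  exists2 M, 0 < M & forall x, a <= x -> x <= b -> `|f x| <= M.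
Proof.
move=> acf; have [ab|ba] := leP a b; last first.
  by exists 1 => // x ax xb; move: ba; rewrite ltNge (le_trans ax xb).
have bv := abs_cont_bounded_variation ab acf.
exists (1 + `|f a| + fine (total_variation a b f)).
  by rewrite ltr_pwDl ?ltr_pwDl ?fine_ge0 ?total_variation_ge0.
move=> x ax xb; apply: (@le_trans _ _ (`|f a| + fine (total_variation a b f))).
  rewrite -lerBlDl (le_trans (lerB_dist _ _))// -lee_fin fineK; last first.
    exact/bounded_variationP.
  rewrite (le_trans (total_variation_ge _ ax))//.
  by rewrite (total_variationD f ax xb) leeDl// total_variation_ge0.
by rewrite -addrA lerDr.
Qed.

Lemma fine_TVB a b f x y : bounded_variation a b f -> a <= x -> x <= y -> y <= b ->
  fine (total_variation a y f) - fine (total_variation a x f) =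
  fine (total_variation x y f).
Proof.
move=> bv ax xy yb.
have bvy := bounded_variationl (le_trans ax xy) yb bv.
rewrite (total_variationD f ax xy) fineD; first by rewrite addrC addKr.
  by apply/(bounded_variationP _ ax); apply: bounded_variationl bvy.
by apply/(bounded_variationP _ xy); apply: bounded_variationr bvy.
Qed.

Lemma near_total_variation a b f x y e : bounded_variation a b f ->
  a <= x -> x <= y -> y <= b -> 0 < e ->
  exists s : seq (R * R),
    [/\ {in s, forall p, [/\ x <= p.1, p.1 <= p.2 & p.2 <= y]},
     pairwise nonoverlap s, \sum_(p <- s) (p.2 - p.1) <= y - x &
     fine (total_variation x y f) <= \sum_(p <- s) `|f p.2 - f p.1| + e].
Proof.
move=> bv ax xy yb e0.
have bvy := bounded_variationl (le_trans ax xy) yb bv.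
have fin : total_variation x y f \is a fin_num.
  by apply/(bounded_variationP _ xy); apply: bounded_variationr bvy.
have [_ [_ [l [xl /eqP ly] <-] <-]] := ub_ereal_sup_adherent e0 fin.
rewrite -/(total_variation x y f) => lt.
have [P1 P2] := pairmap_path xl; exists (pairmap pair x l); split => //.
- by move=> p /P1[? ? ?]; split => //; rewrite -ly.
- by rewrite sum_pairmap ly.
- rewrite -(variation_pairmap x y) -lerBlDr -lee_fin EFinB fineK//.
  exact: ltW.
Qed.

(** Near-optimal partitions of the individual intervals are concatenated; each costs an error [e],
    and intervals that come from different pieces stay nonoverlapping. *)
Lemma near_sum_total_variation a b f n (u v : nat -> R) e :
  bounded_variation a b f -> 0 < e ->
  (forall k, (k < n)%N -> a <= u k /\ u k <= v k /\ v k <= b) ->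
  (forall i j, (i < n)%N -> (j < n)%N -> i <> j -> v i <= u j \/ v j <= u i) ->
  exists s : seq (R * R),
    [/\ {in s, forall p, exists2 k, (k < n)%N & [/\ u k <= p.1, p.1 <= p.2 & p.2 <= v k]},
     pairwise nonoverlap s, \sum_(p <- s) (p.2 - p.1) <= \sum_(k < n) (v k - u k) &
     \sum_(k < n) fine (total_variation (u k) (v k) f) <=
       \sum_(p <- s) `|f p.2 - f p.1| + n%:R * e].
Proof.
move=> bv e0; elim: n => [|n IH] uv dis.
  by exists [::]; split => //; rewrite ?big_ord0 ?big_nil ?mul0r ?addr0.
have [||s [s1 s2 s3 s4]] := IH.
- by move=> k kn; apply: uv; exact: ltnW.
- by move=> i j /ltnW ni /ltnW nj; apply: dis.
have [un [unv vn]] := uv n (ltnSn n).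
have [t [t1 t2 t3 t4]] := near_total_variation bv un unv vn e0.
exists (s ++ t); split.
- move=> p; rewrite mem_cat => /orP[/s1[k kn ?]|/t1 ?]; last by exists n.
  by exists k => //; exact: ltnW.
- rewrite pairwise_cat s2 t2 !andbT; apply/allrelP => p q /s1[k kn [? ? pv]] /t1[uq ? qv].
  have /orP := dis k n (ltnW kn) (ltnSn n) (elimN eqP (negbT (ltn_eqF kn))).
  rewrite /nonoverlap => /orP[h|h].
    by rewrite (le_trans pv (le_trans h uq)).
  by rewrite (le_trans qv (le_trans h _)) ?orbT.
- by rewrite big_cat/= big_ord_recr/= lerD.
- by rewrite big_cat/= big_ord_recr/= -natr1 mulrDl mul1r addrACA lerD.
Qed.

(** Replacing each interval by a near-optimal partition of it does not increase the total length, so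
    the [delta] of [f] for [e / 2] also serves the variation; the other [e / 2] absorbs the
    approximation errors. *)
Lemma abs_cont_total_variation a b f : a <= b -> abs_cont a b f ->
  abs_cont a b (fun x => fine (total_variation a x f)).
Proof.
move=> ab acf e e0; have bv := abs_cont_bounded_variation ab acf.
have e20 : 0 < e / 2 by rewrite divr_gt0.
have [delta d0 H] := abs_cont_seq acf e20; exists delta => // n u v uv dis sd.
(* With [n.+1] instead of [n] the tolerance is positive even for the empty family. *)
have e30 : 0 < e / 2 / n.+1%:R by rewrite divr_gt0.
have [s [s1 s2 s3 s4]] := near_sum_total_variation bv e30 uv dis.
rewrite (eq_bigr (fun k : 'I_n => fine (total_variation (u k) (v k) f))); last first.
  move=> k _; have [au [uvk vb]] := uv k (ltn_ord k).
  by rewrite (fine_TVB bv)// ger0_norm// fine_ge0// total_variation_ge0.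
rewrite (le_lt_trans s4)// [ltRHS]splitr ltr_leD//.
  apply: H => //; last exact: le_lt_trans sd.
  move=> p /s1[k /uv[? [? ?]] [? ? ?]]; split => //; first exact: le_trans (_ : u k <= _).
  exact: le_trans (_ : v k <= _).
by rewrite mulrCA ger_pMr// ler_pdivrMr// mul1r ler_nat.
Qed.

Lemma abs_contN a b f : abs_cont a b f -> abs_cont a b (fun x => - f x).
Proof.
move=> acf e e0; have [d d0 H] := acf e e0; exists d => // n u v uv dis sd.
by under eq_bigr do rewrite -opprD normrN; exact: H.
Qed.

Lemma abs_contD a b f g : abs_cont a b f -> abs_cont a b g ->
  abs_cont a b (fun x => f x + g x).
Proof.
move=> acf acg e e0; have e20 : 0 < e / 2 by rewrite divr_gt0.
have [d1 d10 H1] := acf _ e20; have [d2 d20 H2] := acg _ e20.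
exists (Num.min d1 d2); first by rewrite lt_min d10.
move=> n u v uv dis; rewrite lt_min => /andP[s1 s2].
have := ltrD (H1 n u v uv dis s1) (H2 n u v uv dis s2).
rewrite -splitr -big_split/=; apply: le_lt_trans; apply: ler_sum => k _.
by rewrite opprD addrACA ler_normD.
Qed.

Lemma abs_contM a b f g : abs_cont a b f -> abs_cont a b g ->
  abs_cont a b (fun x => f x * g x).
Proof.
move=> acf acg e e0.
have [M M0 fM] := abs_cont_bounded acf; have [N N0 gN] := abs_cont_bounded acg.
have e20 : 0 < e / 2 / N by rewrite !divr_gt0.
have e30 : 0 < e / 2 / M by rewrite !divr_gt0.
have [d1 d10 H1] := acf _ e20; have [d2 d20 H2] := acg _ e30.
exists (Num.min d1 d2); first by rewrite lt_min d10.
move=> n u v uv dis; rewrite lt_min => /andP[s1 s2].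
have {}H1 := H1 n u v uv dis s1; have {}H2 := H2 n u v uv dis s2.
rewrite ltr_pdivlMr// mulr_suml in H1; rewrite ltr_pdivlMr// mulr_suml in H2.
have := ltrD H1 H2; rewrite -splitr -big_split/=; apply: le_lt_trans.
apply: ler_sum => k _; have [au [uvk vb]] := uv k (ltn_ord k).
have -> : f (v k) * g (v k) - f (u k) * g (u k) =
  (f (v k) - f (u k)) * g (v k) + f (u k) * (g (v k) - g (u k)) by ring.
rewrite (le_trans (ler_normD _ _))// !normrM lerD//.
  by rewrite ler_wpM2l// gN// (le_trans au).
by rewrite mulrC ler_wpM2l// fM// (le_trans uvk).
Qed.

Lemma lipschitz_abs_cont a b f L :
  (forall x y, a <= x -> x <= y -> y <= b -> `|f y - f x| <= L * (y - x)) ->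
  abs_cont a b f.
Proof.
move=> lip e e0; have L10 : 0 < `|L| + 1 by rewrite ltr_wpDl.
exists (e / (`|L| + 1)); first by rewrite divr_gt0.
move=> n u v uv _; rewrite ltr_pdivlMr// mulr_suml; apply: le_lt_trans.
apply: ler_sum => k _; have [au [uvk vb]] := uv k (ltn_ord k).
rewrite (le_trans (lip _ _ au uvk vb))// mulrC ler_wpM2l ?subr_ge0//.
by rewrite (le_trans (ler_norm _))// lerDl.
Qed.

Lemma abs_cont_continuous a b f : abs_cont a b f -> {within `[a, b], continuous f}.
Proof.
move=> acf; apply/subspace_continuousP => x; rewrite /= in_itv/= => /andP[ax xb].
apply/cvgrPdist_lt => e e0; have [delta d0 H] := abs_cont_uniform acf e0.
rewrite near_withinE; near=> y => /=; rewrite in_itv/= => /andP[ay yb].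
have xyd : `|x - y| < delta by near: y; apply: nbhsx_ballx.
have [xy|/ltW yx] := leP x y.
  by rewrite distrC H//; move: xyd; rewrite distrC ger0_norm ?subr_ge0.
by rewrite H//; move: xyd; rewrite ger0_norm ?subr_ge0.
Unshelve. all: by end_near. Qed.

Lemma abs_cont_scale a b k f : abs_cont a b f -> abs_cont a b (fun x => k * f x).
Proof.
apply: abs_contM; apply: (@lipschitz_abs_cont _ _ _ 0) => x y *.
by rewrite subrr normr0 mul0r.
Qed.

(** By compactness [|f|] attains a positive minimum [|f c|], and [1 / f v - 1 / f u] is at most
    [|f v - f u| / |f c|^2] in absolute value. *)
Lemma abs_contV a b f :
  a <= b -> (forall x, a <= x -> x <= b -> f x != 0) -> abs_cont a b f ->
  abs_cont a b (fun x => (f x)^-1).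
Proof.
move=> ab f0 acf.
have cf : {within `[a, b], continuous (fun x => `|f x|)}.
  apply/subspace_continuousP => x xab; apply: cvg_norm.
  by have /subspace_continuousP := abs_cont_continuous acf; exact.
have [c] := EVT_min ab cf; rewrite in_itv/= => /andP[ac cb] cmin.
have fc0 : 0 < `|f c| by rewrite normr_gt0 f0.
move=> e e0; have [d d0 H] := acf (e * (`|f c| * `|f c|)) (mulr_gt0 e0 (mulr_gt0 fc0 fc0)).
exists d => // n u v uv dis sd; have {}H := H n u v uv dis sd.
rewrite -ltr_pdivrMr ?mulr_gt0// mulr_suml in H; apply: le_lt_trans H.
apply: ler_sum => k _; have [au [uvk vb]] := uv k (ltn_ord k).
have fu : f (u k) != 0 by rewrite f0// (le_trans uvk).
have fv : f (v k) != 0 by rewrite f0// (le_trans au).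
have -> : (f (v k))^-1 - (f (u k))^-1 = (f (u k) - f (v k)) / (f (u k) * f (v k)).
  by field; rewrite ?fu ?fv.
rewrite normrM normfV distrC ler_wpM2l// lef_pV2 ?posrE ?normr_gt0 ?mulf_neq0 ?mulr_gt0//.
by rewrite normrM ler_pM// cmin// in_itv/= ?au ?vb ?(le_trans au) ?(le_trans uvk).
Qed.

End AbsCont.

(** * Densities of absolutely continuous functions *)

Section MonotoneDensity.
Context {R : realType}.
Notation mu := (@lebesgue_measure R).

(** The endpoints are the infimum and supremum of the trace. The infimum is not attained, because
    [I] is open and [a] is excluded; the supremum may be attained at [b], which is why two
    inclusions are stated. *)
Lemma open_interval_setI_itv (a b : R) (I : set R) : open I -> is_interval I ->
  I `&` `]a, b] !=set0 ->
  exists u v, [/\ a <= u, u < v, v <= b, I `&` `]a, b] `<=` `]u, v] &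
    `]u, v[ `<=` I `&` `]a, b]].
Proof.
move=> oI iI [z [Iz zab]]; move: (zab); rewrite /= in_itv/= => /andP[az zb].
pose J := I `&` `]a, b].
have Jz : J z by split.
have hs : has_sup J.
  by split; [exists z|exists b => y [_]; rewrite /= in_itv/= => /andP[]].
have hi : has_inf J.
  by split; [exists z|exists a => y [_]; rewrite /= in_itv/= => /andP[/ltW]].
have ltJ y : J y -> inf J < y.
  move=> [Iy]; rewrite /= in_itv/= => /andP[ay yb].
  have nI : \forall t \near y^'-, I t /\ a < t /\ t < y.
    near=> t; split; last first.
      split; first by near: t; exact: nbhs_left_gt.
      by near: t; exact: nbhs_left_lt.
    by near: t; apply: cvg_within; exact: open_nbhs_nbhs.
  have [t [It [at_ ty]]] := @filter_ex _ (y^'-) _ _ nI.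
  apply: (le_lt_trans _ ty); apply: (ge_inf hi.2).
  by split => //; rewrite /= in_itv/= at_/= (le_trans (ltW ty) yb).
have zsup : z <= sup J by exact: (ub_le_sup hs.2).
exists (inf J), (sup J); split.
- by apply: lb_le_inf; [exists z|move=> y [_]; rewrite /= in_itv/= => /andP[/ltW]].
- exact: lt_le_trans (ltJ _ Jz) zsup.
- by apply: ge_sup; [exists z|move=> y [_]; rewrite /= in_itv/= => /andP[]].
- by move=> y Jy; rewrite /= in_itv/= ltJ//=; exact: (ub_le_sup hs.2).
- move=> y; rewrite /= in_itv/= => /andP[iy ys].
  have [p [Ip pab] py] : exists2 p, J p & p < y.
    have [|p Jp] := @inf_adherent _ J (y - inf J) _ hi; first by rewrite subr_gt0.
    by rewrite addrC subrK => py; exists p.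
  have [q [Iq qab] yq] : exists2 q, J q & y < q.
    have [|q Jq] := @sup_adherent _ J (sup J - y) _ hs; first by rewrite subr_gt0.
    by rewrite opprB addrC subrK => yq; exists q.
  split; first by apply: (iI p q) => //; rewrite !ltW.
  move: pab qab; rewrite /= !in_itv/= => /andP[ap _] /andP[_ qb].
  by rewrite (lt_trans ap py) (le_trans (ltW yq) qb).
Unshelve. all: by end_near. Qed.

Lemma lebesgue_stieltjes_ocitv (G : cumulative R R) (u v : R) : u <= v ->
  lebesgue_stieltjes_measure G `]u, v] = (G v - G u)%:E.
Proof.
move=> uv; rewrite /lebesgue_stieltjes_measure /measure_extension/=.
rewrite measurable_mu_extE/=; last exact: is_ocitv.
by rewrite wlength_itv_bnd.
Qed.

(** [U] is split into its disjoint open interval components. The trace of each on []a, b]] is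
    squeezed between []u, v[] and []u, v]]: the outer interval bounds its Stieltjes measure by
    [G v - G u], the inner one bounds [v - u] by its Lebesgue measure. Finite subfamilies then fall
    under the hypothesis, and the partial sums pass to the limit. *)
Lemma lebesgue_stieltjes_open_le (G : cumulative R R) (a b e delta : R) (U : set R) :
  (forall (n : nat) (u v : nat -> R),
      (forall k, (k < n)%N -> a <= u k /\ u k <= v k /\ v k <= b) ->
      (forall i j, (i < n)%N -> (j < n)%N -> i <> j -> v i <= u j \/ v j <= u i) ->
      \sum_(k < n) (v k - u k) < delta ->
      \sum_(k < n) `|G (v k) - G (u k)| < e) ->
  a <= b -> open U -> (mu U < delta%:E)%E ->
  (lebesgue_stieltjes_measure G (U `&` `]a, b]) <= e%:E)%E.
Proof.
move=> H ab oU Ud; pose I := open_disjoint_itv oU.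
have mI k : measurable (I k : set R) by apply: open_measurable; exact: open_disjoint_itv_open.
have mIab k : measurable (I k `&` `]a, b] : set (measurableTypeR R)).
  by apply: measurableI; [exact: mI|exact: measurable_itv].
(* An empty trace receives the degenerate pair [(a, a)]; the alternative [uv.2 = a] records this
   case, where overlap is impossible because all left endpoints are at least [a]. *)
have /choice[uv uvP] : forall k, exists uv : R * R,
    [/\ a <= uv.1, uv.1 <= uv.2 /\ (uv.1 < uv.2 \/ uv.2 = a), uv.2 <= b,
    I k `&` `]a, b] `<=` `]uv.1, uv.2] & `]uv.1, uv.2[ `<=` I k `&` `]a, b]].
  move=> k; have [Jk|Jk0] := pselect (I k `&` `]a, b] !=set0).
    have [u [v [? ? ? ? ?]]] := open_interval_setI_itv (@open_disjoint_itv_open _ _ oU k)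
      (@open_disjoint_itv_is_interval _ _ oU k) Jk.
    by exists (u, v); split => //=; split; [exact: ltW|left].
  exists (a, a); split => //= [|x|x]; [by split; [|right]| |].
    by move=> h; case: Jk0; exists x.
  by rewrite /= in_itv/= => /andP[/lt_trans h /h]; rewrite ltxx.
rewrite (open_disjoint_itv_bigcup oU) setI_bigcupl.
apply: (@le_trans _ _ (\sum_(0 <= k <oo)
    lebesgue_stieltjes_measure G (I k `&` `]a, b]))%E).
  apply: measure_sigma_subadditive => //.
  by apply: bigcup_measurable => k _; exact: mIab.
have tJ : trivIset setT (fun k => I k `&` `]a, b]).
  apply/trivIsetP => i j _ _ ij.
  have /trivIsetP/(_ i j Logic.I Logic.I ij) := @open_disjoint_itv_trivIset _ _ oU.
  by rewrite setIACA => ->; rewrite set0I.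
apply: lime_le; first by apply: is_cvg_nneseries => n _ _; exact: measure_ge0.
near=> n; rewrite big_mkord.
pose u k := (uv k).1; pose v k := (uv k).2.
apply: (@le_trans _ _ (\sum_(k < n) (G (v k) - G (u k))%:E)%E).
  apply: lee_sum => k _; have [au [uvk _] vb sub _] := uvP k.
  rewrite -lebesgue_stieltjes_ocitv//; apply: le_measure => //; rewrite inE//.
rewrite sumEFin lee_fin ltW//; apply: (le_lt_trans (ler_sum _ (fun i _ => ler_norm _))).
apply: (H n u v).
- by move=> k _; have [? []] := uvP k.
- move=> i j _ _ /eqP ij; have [aui [_ uvi] _ _ subi] := uvP i.
  have [auj [_ uvj] _ _ subj] := uvP j.
  apply/orP; rewrite -[_ || _]negbK negb_or -!ltNge; apply/negP => /andP[ji ij'].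
  case: uvi => [uvi|vi]; last by move: ji; rewrite /v vi ltNge auj.
  case: uvj => [uvj|vj]; last by move: ij'; rewrite /v vj ltNge aui.
  have mM : Num.max (u i) (u j) < Num.min (v i) (v j).
    by rewrite gt_max !lt_min uvi ij' ji.
  (* If the two intervals overlapped, this midpoint would lie in two disjoint components. *)
  pose w := (Num.max (u i) (u j) + Num.min (v i) (v j)) / 2.
  have : Num.max (u i) (u j) < w by rewrite midf_lt.
  have : w < Num.min (v i) (v j) by rewrite midf_lt.
  rewrite lt_min gt_max => /andP[wi wj] /andP[iw jw].
  have /trivIsetP/(_ i j Logic.I Logic.I ij) /disjoints_subset/(_ w) := tJ.
  by apply; [apply: subi|apply: subj]; rewrite /= in_itv/= ?iw ?jw.
- rewrite -lte_fin -sumEFin (le_lt_trans _ Ud)//.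
  apply: (@le_trans _ _ (\sum_(k < n) mu (I k `&` `]a, b]))%E).
    apply: lee_sum => k _; have [_ _ _ _ sub] := uvP k.
    apply: (@le_trans _ _ (mu `]u k, v k[)).
      rewrite lebesgue_measure_itv/= lte_fin; case: ifPn => //.
      by rewrite -leNgt => h; rewrite lee_fin subr_le0.
    by apply: le_measure => //; rewrite inE//.
  rewrite -(big_mkord xpredT (fun k => mu (I k `&` `]a, b]))).
  apply: le_trans (nneseries_lim_ge _ _) _ => //.
  rewrite -measure_semi_bigcup//.
  + apply: le_measure => //; rewrite ?inE.
    * by apply: bigcup_measurable => k _; exact: mIab.
    * exact: open_measurable.
    * by rewrite -setI_bigcupl [X in _ `<=` X](open_disjoint_itv_bigcup oU); exact: subIsetl.
  + by apply: bigcup_measurable => k _; exact: mIab.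
Unshelve. all: by end_near. Qed.

(** Outer regularity encloses the null set in an open set of measure below [d], to which the
    previous bound applies for every [e]. *)
Lemma lebesgue_stieltjes_abs_cont_null (G : cumulative R R) (a b : R)
    (A : set (measurableTypeR R)) :
  a <= b -> abs_cont a b G -> measurable A -> mu A = 0%E ->
  lebesgue_stieltjes_measure G (A `&` `]a, b]) = 0%E.
Proof.
move=> ab acG mA A0; apply/eqP; rewrite eq_le measure_ge0 andbT.
apply/lee_addgt0Pr => e e0; rewrite add0e.
have [d d0 H] := acG e e0.
have Aoo : (mu A < +oo)%E by rewrite A0.
have [U [oU AU UAd]] := @lebesgue_regularity_outer R A d mA Aoo d0.
have mU : measurable (U : set (measurableTypeR R)) by exact: open_measurable.
have Ud : (mu U < d%:E)%E.
  by rewrite -(setDKU AU) measureU0//; exact: measurableD.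
apply: le_trans (lebesgue_stieltjes_open_le H ab oU Ud).
apply: le_measure; rewrite ?inE; [apply: measurableI => //; exact: measurable_itv..|].
exact: setSI.
Qed.

(** The Stieltjes measure restricted to []a, b]] is finite and dominated by Lebesgue measure; [h] is
    its Radon-Nikodym derivative, evaluated on []a, x]]. *)
Lemma monotone_abs_cont_density (G : cumulative R R) (a b : R) :
  a <= b -> abs_cont a b G ->
  exists2 h : R -> R, mu.-integrable setT (EFin \o h) &
    forall x, a <= x -> x <= b -> G x - G a = \int[mu]_(t in `[a, x]) h t.
Proof.
move=> ab acG.
have mD : measurable (`]a, b] : set (measurableTypeR R)) by exact: measurable_itv.
have moo : (lebesgue_stieltjes_measure G `]a, b] < +oo)%E.
  by rewrite lebesgue_stieltjes_ocitv// ltry.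
have dom : mfrestr mD moo `<< mu.
  apply/null_content_dominatesP => A mA A0.
  exact: lebesgue_stieltjes_abs_cont_null.
have [h [h0 hfin hint hE]] := radon_nikodym_sigma_finite dom.
have EFh : EFin \o (fine \o h) = h by apply/funext => t /=; rewrite fineK.
exists (fine \o h); first by rewrite EFh.
move=> x ax xb.
have mx : measurable (`]a, x] : set (measurableTypeR R)) by exact: measurable_itv.
rewrite /Rintegral; under eq_integral do rewrite /= fineK//.
rewrite -integral_itv_obnd_cbnd.
  have -> : (\int[mu]_(t in `]a, x]) h t)%E = (G x - G a)%:E.
    rewrite -(hE _ mx) -lebesgue_stieltjes_ocitv//.
    congr (lebesgue_stieltjes_measure G _); apply/setIidPl.
    by apply: subset_itvl; rewrite bnd_simp.
  by [].
exact: measurable_funS (measurable_int _ hint).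
Qed.

End MonotoneDensity.

(** * Retraction of the line onto a segment *)

Section Clamp.
Context {R : realType}.
Implicit Types (a b x y : R).

Definition clamp a b x := Num.max a (Num.min b x).

Lemma clamp_ge a b x : a <= clamp a b x.
Proof. by rewrite le_max lexx. Qed.

Lemma clamp_le a b x : a <= b -> clamp a b x <= b.
Proof. by move=> ab; rewrite ge_max ab ge_min lexx. Qed.

Lemma clamp_id a b x : a <= x -> x <= b -> clamp a b x = x.
Proof. by move=> ax xb; rewrite /clamp min_r// max_r. Qed.

Lemma clamp_homo a b : {homo clamp a b : x y / x <= y}.
Proof.
move=> x y xy; rewrite /clamp; case: (leP b x) => ?; case: (leP b y) => ?;
  case: (leP a b) => ?; case: (leP a x) => ?; case: (leP a y) => ?; lra.
Qed.

Lemma clampB_le a b x y : x <= y -> clamp a b y - clamp a b x <= y - x.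
Proof.
move=> xy; rewrite /clamp; case: (leP b x) => ?; case: (leP b y) => ?;
  case: (leP a b) => ?; case: (leP a x) => ?; case: (leP a y) => ?; lra.
Qed.

Lemma clamp_dist a b x y : `|clamp a b x - clamp a b y| <= `|x - y|.
Proof.
wlog xy : x y / x <= y.
  by move=> W; have [/W//|/ltW/W] := leP x y; rewrite distrC [leRHS]distrC.
rewrite distrC [leRHS]distrC !ger0_norm ?subr_ge0 ?clamp_homo//.
exact: clampB_le.
Qed.

End Clamp.

(** * Integral representation and almost everywhere differentiation *)

Section AbsContFTC.
Context {R : realType}.
Notation mu := (@lebesgue_measure R).

Lemma nondecreasing_abs_cont_density (g : R -> R) (a b : R) :
  a <= b -> {in `[a, b] &, {homo g : x y / x <= y}} -> abs_cont a b g ->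
  exists2 h : R -> R, mu.-integrable setT (EFin \o h) &
    forall x, a <= x -> x <= b -> g x - g a = \int[mu]_(t in `[a, x]) h t.
Proof.
(* A cumulative function must be nondecreasing and right-continuous on the whole line, so [g] is
   continued by constants outside the segment. *)
move=> ab ndg acg; pose cl := clamp a b.
have nd : {homo g \o cl : x y / x <= y}.
  by move=> x y xy; apply: ndg; rewrite ?in_itv/= ?clamp_ge ?clamp_le// clamp_homo.
have rc : right_continuous (g \o cl).
  move=> x; apply/cvgrPdist_lt => e e0.
  have [d d0 H] := abs_cont_uniform acg e0.
  near=> y; have xy : x < y by near: y; exact: nbhs_right_gt.
  rewrite distrC; apply: H; [exact: clamp_ge|exact/clamp_homo/ltW|exact: clamp_le|].
  rewrite (le_lt_trans (clampB_le _ _ (ltW xy)))// ltrBlDl.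
  by near: y; apply: nbhs_right_lt; rewrite ltrDl.
pose G : cumulative R R := HB.pack (g \o cl) (isCumulative.Build R _ R (g \o cl) nd rc).
have acG : abs_cont a b G.
  move=> e e0; have [d d0 H] := acg e e0; exists d => // n u v uv dis sd.
  rewrite (eq_bigr (fun k : 'I_n => `|g (v k) - g (u k)|)); first exact: H.
  move=> k _ /=; have [au [uvk vb]] := uv k (ltn_ord k).
  by rewrite /cl !clamp_id// ?(le_trans au uvk)// (le_trans uvk vb).
have [h hint hE] := monotone_abs_cont_density ab acG.
exists h => // x ax xb; rewrite -hE//=.
by rewrite /cl !clamp_id.
Unshelve. all: by end_near. Qed.

Lemma abs_cont_density (f : R -> R) (a b : R) : a <= b -> abs_cont a b f ->
  exists2 h : R -> R, mu.-integrable setT (EFin \o h) &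
    forall x, a <= x -> x <= b -> f x - f a = \int[mu]_(t in `[a, x]) h t.
Proof.
move=> ab acf; have bv := abs_cont_bounded_variation ab acf.
pose V x := fine (total_variation a x f).
have acV : abs_cont a b V by exact: abs_cont_total_variation.
have acN : abs_cont a b (fun x => V x - f x).
  by apply: abs_contD => //; exact: abs_contN.
(* This inequality makes both [V] and [V - f] nondecreasing. *)
have TVge x y : a <= x -> x <= y -> y <= b -> `|f y - f x| <= V y - V x.
  move=> ax xy yb; rewrite /V (fine_TVB bv)// -lee_fin fineK.
    exact: total_variation_ge.
  have bvy := bounded_variationl (le_trans ax xy) yb bv.
  by apply/(bounded_variationP _ xy); apply: bounded_variationr bvy.
have [|h1 h1int h1E] := nondecreasing_abs_cont_density ab _ acV.
  move=> x y; rewrite !in_itv/= => /andP[ax _] /andP[_ yb] xy.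
  by rewrite -subr_ge0 (le_trans _ (TVge _ _ ax xy yb)).
have [|h2 h2int h2E] := nondecreasing_abs_cont_density ab _ acN.
  move=> x y; rewrite !in_itv/= => /andP[ax _] /andP[_ yb] xy.
  have := TVge _ _ ax xy yb; have := ler_norm (f y - f x); lra.
exists (fun x => h1 x - h2 x); first exact: (integrableB measurableT h1int h2int).
move=> x ax xb; have mx : measurable (`[a, x] : set R) by exact: measurable_itv.
rewrite RintegralB//; last 2 first.
- exact: integrableS h1int.
- exact: integrableS h2int.
by rewrite -h1E// -h2E//; ring.
Qed.

Lemma is_derive_dquot (f : R -> R) (x d : R) :
  is_derive x 1 f d <-> dquot f x @ x^' --> d.
Proof.
split.
  move=> /is_derive1_caratheodory[g [fE cg <-]].
  apply: cvg_trans (cvg_trans (cvg_app _ (@nbhs_dnbhs _ _)) cg).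
  apply: near_eq_cvg; near=> y.
  have yx : y - x != 0 by rewrite subr_eq0; near: y; exact: nbhs_dnbhs_neq.
  by rewrite /dquot fE mulfK.
move=> fd; apply/is_derive1_caratheodory.
(* The difference quotient, completed by [d] at [x], is the slope function of Carathéodory's
   criterion. *)
exists (fun y => if y == x then d else dquot f x y); split.
- move=> z; case: eqVneq => [->|zx]; first by rewrite !subrr mulr0.
  by rewrite /dquot divfK// subr_eq0.
- apply/cvgrPdist_lt => e e0 /=; rewrite eqxx.
  move/cvgrPdist_lt : fd => /(_ e e0); rewrite /dnbhs near_withinE.
  apply: filterS => y H; case: eqVneq => [_|/H//]; by rewrite subrr normr0.
- by rewrite eqxx.
Unshelve. all: by end_near. Qed.

Lemma density_derive (f h : R -> R) (a b : R) :
  mu.-integrable setT (EFin \o h) ->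
  (forall x, a <= x -> x <= b -> f x - f a = \int[mu]_(t in `[a, x]) h t) ->
  {ae mu, forall x, a < x -> x < b -> dquot f x @ x^' --> h x}.
Proof.
move=> hint fE.
have int y : mu.-integrable [set` Interval (BLeft a) (BRight y)] (EFin \o h).
  by apply: integrableS hint => //; exact: measurable_itv.
have loc : locally_integrable [set: R] h by exact: (open_integrable_locally openT).
have := FTC1 int loc; apply: filterS.
  exact: (ae_filter_ringOfSetsType mu).
move=> x H ax xb.
have [|dF <-] := H; first by rewrite /= lte_fin.
(* Inside []a, b[] the indefinite integral [F] differs from [f] by the constant [f a], so both have
   the same difference quotients near [x]. *)
set F := (fun x => _) in dF *.
have /is_derive_dquot : is_derive x 1 F (derive1 F x).
  by rewrite derive1E; exact: derivableP.
apply: cvg_trans; apply: near_eq_cvg; near=> y.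
have [ay yb] : a <= y /\ y <= b.
  split; apply: ltW; near: y; apply: nbhs_dnbhs; [exact: lt_nbhsr|exact: lt_nbhsl].
by rewrite /dquot /F -!fE ?(ltW ax) ?(ltW xb)//; congr (_ / _); ring.
Unshelve. all: by end_near. Qed.

End AbsContFTC.

(** * Derivatives relative to the half-open interval *)

Section RelativeDerivative.
Context {R : realType}.
Notation mu := (@lebesgue_measure R).
Variables (T : R) (x0 : \bar R).
Notation I := (Iset T x0).

Lemma Iset_convex a b x : I a -> I b -> a <= x -> x <= b -> I x.
Proof.
move=> [Ta _] [_ bx0] ax xb; split; first exact: le_trans ax.
by apply: le_lt_trans bx0; rewrite lee_fin.
Qed.

Lemma Iset_gt x : I x -> exists2 y, I y & x < y.
Proof.
move=> [Tx xx0]; have [y xy yx0] : exists2 y, x < y & (y%:E < x0)%E.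
  case: x0 xx0 => [r| |//].
    by rewrite lte_fin => xr; exists ((x + r) / 2); rewrite ?lte_fin ?midf_lt.
  by move=> _; exists (x + 1); rewrite ?ltrDl ?ltry.
by exists y => //; split => //; rewrite ltW// (le_lt_trans Tx).
Qed.

(** Every point of the interval, [T] included, has points of the interval immediately to its right;
    this gives uniqueness of relative derivatives. *)
Lemma within_Iset_proper x : I x -> ProperFilter (within I x^').
Proof.
move=> Ix; have [y Iy xy] := Iset_gt Ix.
apply: Build_ProperFilter_ex => P; rewrite /within/= => nP.
have : \forall z \near x^'+, (I z -> P z) /\ x < z /\ z < y.
  near=> z; have xz : x < z by near: z; exact: nbhs_right_gt.
  split; last by split => //; near: z; exact: nbhs_right_lt.
  move: xz; near: z; move: nP; rewrite /dnbhs !near_withinE; apply: filterS => z H zx.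
  by move=> _; apply: H; rewrite gt_eqF.
move=> /(@filter_ex _ _ (at_right_proper_filter x))[z [IP [xz zy]]].
by exists z; apply: IP; apply: (Iset_convex Ix Iy); exact: ltW.
Unshelve. all: by end_near. Qed.

Lemma near_Iset x : T < x -> I x -> \forall y \near x, I y.
Proof.
move=> Tx Ix; have [z Iz xz] := Iset_gt Ix.
near=> y; split; first by apply: ltW; near: y; exact: lt_nbhsr.
apply: lt_trans Iz.2; rewrite lte_fin; near: y; exact: lt_nbhsl.
Unshelve. all: by end_near. Qed.

(** Only at [T] does the relative derivative differ from the two-sided one. *)
Lemma within_Iset_dnbhs x : T < x -> I x -> within I x^' = x^'.
Proof.
move=> Tx Ix; apply/seteqP; split; last by move=> P; exact: cvg_within.
move=> P; rewrite /within/= => nP.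
by apply: filterS2 (nbhs_dnbhs (near_Iset Tx Ix)) nP => y Iy; exact.
Qed.

Lemma derivI_dI f x d : I x -> derivI T x0 f x d -> dI T x0 f x = d.
Proof.
move=> /within_Iset_proper FF fd; apply: cvg_lim => //.
Qed.

Lemma derivableI_dI f x : I x -> derivableI T x0 f x ->
  derivI T x0 f x (dI T x0 f x).
Proof. by move=> Ix [d fd]; rewrite (derivI_dI Ix fd). Qed.

Lemma derivI_continuous f x d : I x -> derivI T x0 f x d ->
  f y @[y --> within I x^'] --> f x.
Proof.
move=> Ix fd; have FF := within_Iset_proper Ix.
have : dquot f x y * (y - x) + f x @[y --> within I x^'] --> d * (x - x) + f x.
  apply: cvgD; last exact: cvg_cst; apply: cvgM => //.
  apply: cvgB; last exact: cvg_cst.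
  apply: cvg_trans (@nbhs_dnbhs _ x); apply: cvg_within.
rewrite subrr mulr0 add0r; apply: cvg_trans; apply: near_eq_cvg.
near=> y; have yx : y - x != 0.
  by rewrite subr_eq0; near: y; exact: (@cvg_within _ _ _ I _ (nbhs_dnbhs_neq x)).
by rewrite /dquot divfK// subrK.
Unshelve. all: by end_near. Qed.

Lemma derivableI_within_continuous f : (forall x, I x -> derivableI T x0 f x) ->
  {within I, continuous f}.
Proof.
move=> df; apply/subspace_continuousP => x Ix; have [d fd] := df x Ix.
have := derivI_continuous Ix fd; move=> /cvgrPdist_lt H; apply/cvgrPdist_lt => e e0.
have := H e e0; rewrite /dnbhs !near_withinE; apply: filterS => y.
by case: (eqVneq y x) => [->|_ h Iy]; [rewrite subrr normr0|exact: h].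
Qed.

Lemma derivI_div f p x df dp : I x -> p x != 0 ->
  derivI T x0 f x df -> derivI T x0 p x dp ->
  derivI T x0 (fun y => f y / p y) x ((df * p x - f x * dp) / p x ^+ 2).
Proof.
move=> Ix px fd pd; have FF := within_Iset_proper Ix.
have cp := derivI_continuous Ix pd.
(* This expression is the difference quotient of [f / p] wherever [p y] is nonzero, which continuity
   of [p] ensures near [x]. *)
have : (dquot f x y * p x - f x * dquot p x y) / (p y * p x)
  @[y --> within I x^'] --> (df * p x - f x * dp) / (p x * p x).
  apply: cvgM; first by apply: cvgB; apply: cvgM => //; exact: cvg_cst.
  apply: cvgV; first by rewrite mulf_neq0.
  by apply: cvgM => //; exact: cvg_cst.
rewrite -expr2; apply: cvg_trans; apply: near_eq_cvg.
near=> y; have yx : y - x != 0.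
  by rewrite subr_eq0; near: y; exact: (@cvg_within _ _ _ I _ (nbhs_dnbhs_neq x)).
have py : p y != 0.
  near: y; have /cvgrPdist_lt/(_ `|p x|) := cp; rewrite normr_gt0 => /(_ px).
  apply: filterS => y; apply: contraPneq => ->; rewrite subr0 ltxx; exact/negP.
by rewrite /dquot; field; rewrite yx px py.
Unshelve. all: by end_near. Qed.

Lemma derivI_lin f g x c df dg : I x ->
  derivI T x0 f x df -> derivI T x0 g x dg ->
  derivI T x0 (fun y => f y + c * g y) x (df + c * dg).
Proof.
move=> Ix fd gd; have FF := within_Iset_proper Ix.
rewrite /derivI (_ : dquot _ x = fun y => dquot f x y + c * dquot g x y).
  by apply: cvgD => //; apply: cvgM => //; exact: cvg_cst.
by apply/funext => y; rewrite /dquot; ring.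
Qed.

Lemma derivI_dquot f x d : T < x -> I x ->
  derivI T x0 f x d <-> dquot f x @ x^' --> d.
Proof. by move=> Tx Ix; rewrite /derivI within_Iset_dnbhs. Qed.

(** The derivative is continuous on a compact segment, hence bounded, and the mean value theorem
    applies; it asks for derivatives at interior points only, where the relative derivative is
    two-sided. *)
Lemma C1I_lipschitz f a b : C1I T x0 f -> I a -> I b -> a <= b ->
  exists L, forall x y, a <= x -> x <= y -> y <= b -> `|f y - f x| <= L * (y - x).
Proof.
move=> [df cdf] Ia Ib ab.
have sub : `[a, b] `<=` I.
  by move=> x /=; rewrite in_itv/= => /andP[ax xb]; exact: (Iset_convex Ia Ib).
have cab : {within `[a, b], continuous (dI T x0 f)} by exact: continuous_subspaceW cdf.
have [L [_ LP]] := compact_bounded (continuous_compact cab (@segment_compact _ a b)).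
exists (L + 1) => x y ax; rewrite le_eqVlt => /predU1P[->|xy] yb.
  by rewrite !subrr normr0 mulr0.
have Ix : I x by apply: (Iset_convex Ia Ib) => //; rewrite (le_trans (ltW xy)).
have Iy : I y by apply: (Iset_convex Ia Ib) => //; rewrite (le_trans ax (ltW xy)).
have cf : {within `[x, y], continuous f}.
  apply: continuous_subspaceW (derivableI_within_continuous df) => z /=.
  by rewrite in_itv/= => /andP[xz zy]; exact: (Iset_convex Ix Iy).
have [z|z] := @MVT _ f (dI T x0 f) x y xy _ cf.
  rewrite in_itv/= => /andP[xz zy].
  have Iz : I z by apply: (Iset_convex Ix Iy); exact: ltW.
  apply/is_derive_dquot/derivI_dquot => //; first exact: le_lt_trans Ix.1 xz.
  by apply: derivableI_dI => //; exact: df.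
rewrite in_itv/= => /andP[xz zy] ->.
rewrite normrM (ger0_norm (_ : 0 <= y - x)) ?subr_ge0 ?(ltW xy)//.
rewrite ler_wpM2r ?subr_ge0 ?(ltW xy)//; apply: (LP (L + 1)); first by rewrite ltrDl.
exists z => //; rewrite /= in_itv/= (le_trans ax (ltW xz))/=.
exact: le_trans (ltW zy) yb.
Qed.

End RelativeDerivative.

(** * Measurability of the derivative of a continuous function *)

Section MeasurableDerivative.
Context {R : realType}.
Variable f : R -> R.
Hypothesis cf : continuous f.

(* By Cauchy's criterion the set of differentiability points is built from the
   sets [osc k m], each closed as an intersection of closed sets. *)
Let osc (k m : nat) := \bigcap_(p in [set p : R * R |
    [/\ p.1 != 0, `|p.1| < m.+1%:R^-1, p.2 != 0 & `|p.2| < m.+1%:R^-1]])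
  [set y | `|dquot f y (y + p.1) - dquot f y (y + p.2)| <= k.+1%:R^-1].

Let continuous_dquot h : continuous (fun y => dquot f y (y + h)).
Proof.
move=> y; rewrite (_ : (fun y => _) = fun y => (f (y + h) - f y) * h^-1); last first.
  by apply/funext => z; rewrite /dquot addrAC subrr add0r.
apply: cvgM; last exact: cvg_cst.
apply: cvgB; last exact: cf.
apply: continuous_comp; last exact: cf.
by apply: cvgD => //; exact: cvg_cst.
Qed.

Let osc_closed k m : closed (osc k m).
Proof.
rewrite /osc; apply: closed_bigI => p _.
apply: (@preimage_closed _ _ (fun y => `|dquot f y (y + p.1) - dquot f y (y + p.2)|)
  [set x | x <= k.+1%:R^-1]); last exact: closed_le.
move=> y _; apply: (@cvg_norm _ _ _ _ _ (fun y => dquot f y (y + p.1) - dquot f y (y + p.2))).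
apply: cvgB; exact: continuous_dquot.
Qed.

Lemma cvg_dquotE :
  [set y | cvg (dquot f y z @[z --> y^'])] = \bigcap_k \bigcup_m osc k m.
Proof.
have inv_small (e : R) : 0 < e -> exists n : nat, n.+1%:R^-1 < e.
  move=> e0; have [n _ H] := near_infty_natSinv_lt (PosNum e0).
  by exists n; apply: H; exact: leqnn.
apply/seteqP; split => y /=.
  move=> /cvg_ex[l /cvgrPdist_lt yl] k _.
  have e20 : 0 < k.+1%:R^-1 / 2 :> R by rewrite divr_gt0.
  have := yl _ e20; rewrite /dnbhs near_withinE => -[/= d d0 H].
  have [m md] := inv_small _ d0; exists m => // -[h h'] /= [h0 hm h'0 h'm].
  have K z : z != 0 -> `|z| < m.+1%:R^-1 -> `|l - dquot f y (y + z)| < k.+1%:R^-1 / 2.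
    move=> z0 zm; apply: H.
      by rewrite /= opprD addNKr normrN (lt_trans zm).
    by rewrite -subr_eq0 addrAC subrr add0r.
  have := K _ h0 hm; have := K _ h'0 h'm.
  rewrite [X in _ <= X]splitr => h2 h1.
  rewrite -(subrKA l) (le_trans (ler_normD _ _))// lerD// ?(distrC _ l) ltW//.
move=> yC; apply: cauchy_cvg; apply: cauchy_exP => e e0.
have [k ke] := inv_small _ e0; have [m _ ym] := yC k Logic.I.
have m0 : 0 < m.+1%:R^-1 :> R by rewrite invr_gt0.
(* Any admissible step below [1 / (m + 1)] can serve as the centre; half of that bound is one. *)
exists (dquot f y (y + m.+1%:R^-1 / 2)).
suff : \forall z \near y^', ball (dquot f y (y + m.+1%:R^-1 / 2)) e (dquot f y z) by [].
near=> z; rewrite -ball_normE/=; apply: le_lt_trans ke.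
have /= := ym (m.+1%:R^-1 / 2, z - y); rewrite [y + (z - y)]addrC subrK; apply.
split; first by rewrite gt_eqF// divr_gt0.
- by rewrite gtr0_norm ?divr_gt0// gtr_pMr// invf_lt1// ltr1n.
- by rewrite subr_eq0; near: z; exact: nbhs_dnbhs_neq.
- rewrite distrC; near: z; apply: nbhs_dnbhs; exact: nbhsx_ballx.
Unshelve. all: by end_near. Qed.

(* [lim] is the junk value [0] off the Borel set [C]; on [C] it is the limit of
   the continuous difference quotients of step [1 / (n + 1)]. *)
Lemma measurable_lim_dquot :
  measurable_fun setT (fun y => lim (dquot f y z @[z --> y^'])).
Proof.
pose C := [set y | cvg (dquot f y z @[z --> y^'])].
have mC : measurable (C : set R).
  rewrite /C cvg_dquotE; apply: bigcapT_measurable => k.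
  by apply: bigcup_measurable => m _; apply: closed_measurable; exact: osc_closed.
apply: (@measurable_fun_cvg _ _ _ _
  (fun n y => \1_C y * dquot f y (y + n.+1%:R^-1))).
  move=> n; apply: measurable_funM; first exact: measurable_indic.
  exact: continuous_measurable_fun.
move=> y _; have [yC|yC] := pselect (C y); last first.
  rewrite (dvgP yC) indicE memNset//=.
  by under eq_fun do rewrite mul0r; exact: cvg_cst.
rewrite indicE mem_set//=; under eq_fun do rewrite mul1r.
have yl : dquot f y z @[z --> y^'] --> lim (dquot f y z @[z --> y^']) by [].
apply: cvg_comp yl.
move=> P /=; rewrite /dnbhs/within/= => -[/= d d0 H].
have := near_infty_natSinv_lt (PosNum d0); apply: filterS => n nd.
apply: H; last by rewrite -subr_eq0 addrAC subrr add0r.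
by rewrite /= opprD addNKr normrN gtr0_norm.
Qed.

End MeasurableDerivative.

(** * Limits at the right endpoint *)

Section AtEndpoint.
Context {R : realType}.
Variables (T : R) (x0 : \bar R).
Hypothesis Tx0 : (T%:E < x0)%E.
Notation I := (Iset T x0).

(** Finite and infinite endpoints are treated here once and for all: afterwards, near [x0] means on
    a tail [[c, x0)] with [c] in the interval. *)
Lemma near_at_x0P (P : R -> Prop) : (\forall x \near at_x0 x0, P x) <->
  exists2 c, I c & forall x, c <= x -> I x -> P x.
Proof.
split.
  case: x0 Tx0 => [r| |//]; rewrite ?lte_fin => Tr.
    rewrite near_withinE => -[/= d d0 H].
    exists (Num.max T (r - d / 2)).
      by split; rewrite ?le_max ?lexx// lte_fin gt_max Tr ltrBlDr ltrDl divr_gt0.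
    move=> x; rewrite ge_max => /andP[_ rx] [_]; rewrite lte_fin => xr; apply: H => //=.
    rewrite gtr0_norm ?subr_gt0//; lra.
  move=> [M [_ H]]; exists (Num.max T (M + 1)).
    by split; rewrite ?le_max ?lexx// ltry.
  move=> x; rewrite ge_max => /andP[_ rx] _; apply: H; lra.
case: x0 Tx0 => [r| |//]; rewrite ?lte_fin => Tr [c [Tc cr] H].
  rewrite lte_fin in cr; rewrite /at_x0.
  near=> x; have cx : c <= x by near: x; exact: nbhs_left_ge.
  apply: H => //; split; first exact: (le_trans Tc).
  by rewrite lte_fin; near: x; exact: nbhs_left_lt.
exists c; split => // x cx; apply: H; first exact: ltW.
by split; [rewrite (le_trans Tc)// ltW|rewrite ltry].
Unshelve. all: by end_near. Qed.

Lemma at_x0_filter : Filter (at_x0 x0).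
Proof. by rewrite /at_x0; case: x0 => *; typeclasses eauto. Qed.

Lemma cvg_at_x0P (g : R -> R) (l : R) : g @ at_x0 x0 --> l <->
  forall e, 0 < e -> exists2 c, I c & forall x, c <= x -> I x -> `|l - g x| < e.
Proof.
have FF := at_x0_filter.
split=> [/cvgrPdist_lt H e e0|H]; first by apply/near_at_x0P; exact: H.
by apply/cvgrPdist_lt => e e0; apply/near_at_x0P; exact: H.
Qed.

End AtEndpoint.

(** * Absolutely continuous functions and their almost everywhere derivatives *)

Section AlmostEverywhere.
Context {R : realType}.
Notation mu := (@lebesgue_measure R).

Lemma lebesgue_ae_filter : Filter (nbhs (almost_everywhere mu)).
Proof. exact: ae_filter_ringOfSetsType. Qed.

Lemma ae_neq (a : R) : {ae mu, forall t : R, t != a}.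
Proof.
exists [set a]; split; [exact: measurable_set1|exact: lebesgue_measure_set1|].
by move=> t /= /negP; rewrite negbK => /eqP.
Qed.

Lemma ae_segment (P : R -> Prop) (a b : R) :
  {ae mu, forall t, a < t -> t < b -> P t} ->
  {ae mu, forall t, `[a, b]%classic t -> P t}.
Proof.
move=> abP; have ab := @filterI _ _ lebesgue_ae_filter _ _ (ae_neq a) (ae_neq b).
apply: (@filterS2 _ _ lebesgue_ae_filter _ _ _ _ abP ab) => t Pt [ta tb].
rewrite /= in_itv/= => /andP[at_ tb_].
by apply: Pt; rewrite lt_neqAle ?tb// eq_sym ta.
Qed.

Lemma cvg_dquot_unique (f : R -> R) (x d d' : R) :
  dquot f x @ x^' --> d -> dquot f x @ x^' --> d' -> d = d'.
Proof. by move=> fd fd'; apply: (cvg_unique _ fd fd'). Qed.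

(** The density [h] of [F] and the given [g] are limits of the same difference quotients at almost
    every point, so they agree almost everywhere, and integrability and integrals pass from [h] to
    [g]. *)
Lemma abs_cont_FTC (F g : R -> R) (a b : R) : a <= b -> abs_cont a b F ->
  measurable_fun `[a, b] g ->
  {ae mu, forall t, a < t -> t < b -> dquot F t @ t^' --> g t} ->
  mu.-integrable `[a, b] (EFin \o g) /\
  forall x, a <= x -> x <= b -> F x - F a = \int[mu]_(t in `[a, x]) g t.
Proof.
move=> ab acF mg Fg; have [h hint hE] := abs_cont_density ab acF.
have hg : {ae mu, forall t, `[a, b]%classic t -> h t = g t}.
  apply: ae_segment.
  apply: (@filterS2 _ _ lebesgue_ae_filter _ _ _ _ (density_derive hint hE) Fg).
  by move=> t Ht Gt at_ tb; exact: cvg_dquot_unique (Ht at_ tb) (Gt at_ tb).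
have mh : measurable_fun setT h by apply/measurable_EFinP; exact: measurable_int hint.
have sub x : x <= b -> `[a, x] `<=` `[a, b].
  by move=> xb; apply: subset_itvl; rewrite bnd_simp.
split.
  apply/integrableP; split; first exact/measurable_EFinP.
  have /integrableP[_ ] : mu.-integrable `[a, b] (EFin \o h).
    by apply: integrableS hint => //; exact: measurable_itv.
  apply: le_lt_trans; rewrite le_eqVlt; apply/orP; left; apply/eqP.
  apply: ae_eq_integral => //.
  - by apply: measurableT_comp => //; exact/measurable_EFinP.
  - by apply: measurableT_comp => //; apply/measurable_EFinP; exact: measurable_funTS.
  - by apply: (@filterS _ _ lebesgue_ae_filter _ _ _ hg) => t ht /ht /= ->.
move=> x ax xb; rewrite hE// /Rintegral; congr fine.
apply: ae_eq_integral => //.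
- by apply/measurable_EFinP; exact: measurable_funTS.
- by apply/measurable_EFinP; apply: measurable_funS mg => //; exact: sub.
- by apply: (@filterS _ _ lebesgue_ae_filter _ _ _ hg) => t ht /(sub _ xb)/ht /= ->.
Qed.

Lemma abs_cont_ae_derivable (f : R -> R) (a b : R) : a <= b -> abs_cont a b f ->
  {ae mu, forall t, a < t -> t < b -> exists d : R, dquot f t @ t^' --> d}.
Proof.
move=> ab acf; have [h hint hE] := abs_cont_density ab acf.
apply: (@filterS _ _ lebesgue_ae_filter _ _ _ (density_derive hint hE)).
by move=> t H at_ tb; exists (h t); exact: H.
Qed.

(** The density is almost everywhere the derivative, so it coincides with its absolute value and has
    a nonnegative integral. *)
Lemma abs_cont_nondecreasing (F : R -> R) (a b : R) : a <= b -> abs_cont a b F ->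
  {ae mu, forall t, a < t -> t < b -> exists2 d : R, 0 <= d & dquot F t @ t^' --> d} ->
  F a <= F b.
Proof.
move=> ab acF Fd; have [h hint hE] := abs_cont_density ab acF.
have mh : measurable_fun setT h by apply/measurable_EFinP; exact: measurable_int hint.
rewrite -subr_ge0 hE// /Rintegral.
have -> : (\int[mu]_(t in `[a, b]) (h t)%:E = \int[mu]_(t in `[a, b]) `|h t|%:E)%E.
  apply: ae_eq_integral => //.
  - by apply/measurable_EFinP; exact: measurable_funTS.
  - by apply/measurable_EFinP; apply: measurableT_comp => //; exact: measurable_funTS.
  - apply: ae_segment.
    apply: (@filterS2 _ _ lebesgue_ae_filter _ _ _ _ (density_derive hint hE) Fd).
    move=> t Ht Gt at_ tb; have [d d0 Fdt] := Gt at_ tb.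
    by rewrite (cvg_dquot_unique (Ht at_ tb) Fdt) ger0_norm.
by rewrite fine_ge0// integral_ge0.
Qed.

Lemma abs_cont_le_increment (P Q : R -> R) (a b : R) : a <= b ->
  abs_cont a b P -> abs_cont a b Q ->
  {ae mu, forall t, a < t -> t < b -> exists p q : R,
    [/\ p <= q, dquot P t @ t^' --> p & dquot Q t @ t^' --> q]} ->
  P b - P a <= Q b - Q a.
Proof.
move=> ab acP acQ PQ.
suff : Q a - P a <= Q b - P b by lra.
apply: (abs_cont_nondecreasing ab (abs_contD acQ (abs_contN acP))).
apply: (@filterS _ _ lebesgue_ae_filter _ _ _ PQ) => t H at_ tb.
have [p [q [pq Pp Qq]]] := H at_ tb; exists (q - p); first by rewrite subr_ge0.
rewrite (_ : dquot _ t = fun y => dquot Q t y - dquot P t y); first exact: cvgB.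
by apply/funext => y; rewrite /dquot; ring.
Qed.

End AlmostEverywhere.

(** * Measurability of the relative derivative *)

Section MeasurableRelativeDerivative.
Context {R : realType}.
Variables (T : R) (x0 : \bar R).
Notation I := (Iset T x0).

(** Composing with a clamp yields a function continuous on the whole line, whose two-sided
    derivative agrees with the relative one on []T, x]]; the point [T], where the derivative is
    one-sided, is split off. *)
Lemma measurable_dI (f : R -> R) x : {within I, continuous f} -> I x ->
  measurable_fun `[T, x] (dI T x0 f).
Proof.
(* Clamping at some [y] beyond [x] leaves the difference quotients at [x] itself unchanged on both
   sides. *)
move=> cf Ix; have [y Iy xy] := Iset_gt Ix.
have IT : I T by split => //; apply: le_lt_trans Ix.2; rewrite lee_fin; case: Ix.
have Ty : T <= y by case: Iy.
pose cl := clamp T y.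
have Icl z : I (cl z).
  by apply: (Iset_convex IT Iy); [exact: clamp_ge|exact: clamp_le].
have cfc : continuous (f \o cl).
  move=> z; apply/cvgrPdist_lt => e e0.
  have /subspace_continuousP/(_ _ (Icl z))/cvgrPdist_lt/(_ _ e0) := cf.
  rewrite near_withinE => -[/= d d0 H]; exists d => //= w zw.
  by apply: H => //=; exact: le_lt_trans (clamp_dist _ _ _ _) zw.
have -> : (`[T, x] = [set T] `|` `]T, x])%classic.
  rewrite eqEsubset; split => z /=; rewrite !in_itv/=.
    by rewrite le_eqVlt => /andP[/predU1P[->|Tz] zx]; [left|right; rewrite Tz].
  case=> [->|/andP[Tz ->]]; first by rewrite lexx; case: Ix.
  by rewrite ltW.
apply/measurable_funU; [exact: measurable_set1|exact: measurable_itv|].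
split; first exact: measurable_fun_set1.
apply: (eq_measurable_fun (fun z => lim (dquot (f \o cl) z w @[w --> z^']))); last first.
  exact: measurable_funTS (measurable_lim_dquot cfc).
move=> z; rewrite inE/= in_itv/= => /andP[Tz zx].
have Iz : I z by apply: (Iset_convex IT Ix) => //; exact: ltW.
rewrite /dI within_Iset_dnbhs//; congr (lim _).
(* The quotients agree near [z], so the two image filters are equal and [lim] has the same value
   even where nothing converges. *)
have E : {near z^', dquot (f \o cl) z =1 dquot f z}.
  near=> w; have [Tw wy] : T <= w /\ w <= y.
    split; apply: ltW; near: w; apply: nbhs_dnbhs; first exact: lt_nbhsr.
    by apply: lt_nbhsl; exact: le_lt_trans zx xy.
  by rewrite /dquot /= /cl !clamp_id// ltW// (le_lt_trans zx).
apply/seteqP; split; apply: near_eq_cvg => //.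
by apply: filterS E => w ->.
Unshelve. all: by end_near. Qed.

End MeasurableRelativeDerivative.

(** * The two-term expansion *)

Section TwoTermExpansion.
Context {R : realType}.
Notation mu := (@lebesgue_measure R).
Variables (x0 : \bar R) (T : R) (phi1 phi2 f : R -> R).
Notation I := (Iset T x0).
Hypothesis Tx0 : (T%:E < x0)%E.
Hypothesis phi1C1 : C1I T x0 phi1.
Hypothesis phi2C1 : C1I T x0 phi2.
Hypothesis phi21 : littleo_at (at_x0 x0) phi2 phi1.
Hypothesis phi2_neq0 : forall x, I x -> phi2 x <> 0.
Hypothesis Wr_neq0 : forall x, I x -> Wr T x0 phi1 phi2 x <> 0.
Hypothesis fAC : ACI T x0 f.

Let q := fun x => phi1 x / phi2 x.
Let fq := fun x => f x / phi2 x.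
Let fs := f1star T x0 phi1 phi2 f.
Let Df := derivableI T x0 f.
Let IT : I T. Proof. by split. Qed.
Let p2 x : I x -> phi2 x != 0. Proof. by move=> Ix; apply/eqP; exact: phi2_neq0. Qed.
Let w0 x : I x -> Wr T x0 phi1 phi2 x != 0.
Proof. by move=> Ix; apply/eqP; exact: Wr_neq0. Qed.

Lemma Iset_max c d : I c -> I d -> I (Num.max c d).
Proof. by move=> Ic Id; case: leP. Qed.

Lemma derivI_q x : I x -> derivI T x0 q x (- Wr T x0 phi1 phi2 x / phi2 x ^+ 2).
Proof.
move=> Ix.
have d1 := derivableI_dI Ix (phi1C1.1 _ Ix).
have d2 := derivableI_dI Ix (phi2C1.1 _ Ix).
have -> : - Wr T x0 phi1 phi2 x =
    dI T x0 phi1 x * phi2 x - phi1 x * dI T x0 phi2 x by rewrite /Wr; ring.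
by apply: derivI_div => //; exact: p2.
Qed.

Lemma dI_qE x : I x -> dI T x0 q x = - Wr T x0 phi1 phi2 x / phi2 x ^+ 2.
Proof. by move=> Ix; apply: derivI_dI => //; exact: derivI_q. Qed.

Lemma dI_q_neq0 x : I x -> dI T x0 q x != 0.
Proof.
move=> Ix; rewrite dI_qE// mulf_neq0// ?oppr_eq0 ?w0//.
by rewrite invr_eq0 expf_neq0// p2.
Qed.

(* Holds also where [f] is not differentiable: both sides then contain the same
   junk value [dI T x0 f x]. *)
Lemma dI_q_fs x : I x ->
  dI T x0 q x * fs x = (dI T x0 f x * phi2 x - f x * dI T x0 phi2 x) / phi2 x ^+ 2.
Proof.
move=> Ix; rewrite dI_qE// /fs /f1star {2}/Wr; field.
by rewrite p2// w0.
Qed.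

Lemma derivI_fq x : I x -> Df x -> derivI T x0 fq x (dI T x0 q x * fs x).
Proof.
move=> Ix dfx; rewrite dI_q_fs//; apply: derivI_div => //; first exact: p2.
  exact: derivableI_dI.
by apply: derivableI_dI => //; exact: phi2C1.1.
Qed.

Lemma abs_cont_C1I phi a b : C1I T x0 phi -> I a -> I b -> a <= b -> abs_cont a b phi.
Proof.
move=> C Ia Ib ab; have [L H] := C1I_lipschitz C Ia Ib ab.
exact: lipschitz_abs_cont H.
Qed.

Lemma abs_cont_inv_phi2 a b : I a -> I b -> a <= b ->
  abs_cont a b (fun x => (phi2 x)^-1).
Proof.
move=> Ia Ib ab; apply: abs_contV => //; last exact: abs_cont_C1I.
by move=> x ax xb; apply: p2; exact: (Iset_convex Ia Ib).
Qed.

Lemma abs_cont_q a b : I a -> I b -> a <= b -> abs_cont a b q.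
Proof.
by move=> *; apply: abs_contM; [exact: abs_cont_C1I|exact: abs_cont_inv_phi2].
Qed.

Lemma within_continuous_q : {within I, continuous q}.
Proof.
by apply: derivableI_within_continuous => x Ix; eexists; exact: derivI_q.
Qed.

Lemma within_continuous_f : {within I, continuous f}.
Proof.
apply/subspace_continuousP => x Ix; have [y Iy xy] := Iset_gt Ix.
apply/cvgrPdist_lt => e e0; have [d d0 H] := abs_cont_uniform (fAC IT Iy Iy.1) e0.
rewrite near_withinE; near=> z => -[Tz _].
have zy : z <= y by apply: ltW; near: z; exact: lt_nbhsl.
have xzd : `|x - z| < d by near: z; exact: nbhsx_ballx.
have [xz|/ltW zx] := leP x z.
  by rewrite distrC H//; [case: Ix|move: xzd; rewrite distrC ger0_norm ?subr_ge0].
by rewrite H// ?(ltW xy)//; move: xzd; rewrite ger0_norm ?subr_ge0.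
Unshelve. all: by end_near. Qed.

(** The Wronskian is continuous without zeros, so by the intermediate value theorem it keeps its
    sign at [T]; the sign of [q'] is the opposite one. *)
Lemma dI_q_sign : exists2 s : R, `|s| = 1 & forall x, I x -> s * dI T x0 q x = `|dI T x0 q x|.
Proof.
have cW : {within I, continuous (Wr T x0 phi1 phi2)}.
  have [d1 c1] := phi1C1; have [d2 c2] := phi2C1.
  have k1 := derivableI_within_continuous d1; have k2 := derivableI_within_continuous d2.
  move=> x; apply: cvgB; apply: cvgM; [exact: k1|exact: c2|exact: c1|exact: k2].
have same x y : I x -> I y -> x <= y -> 0 < Wr T x0 phi1 phi2 x * Wr T x0 phi1 phi2 y.
  move=> Ix Iy xy; rewrite lt_neqAle eq_sym mulf_neq0 ?w0//= leNgt; apply/negP => neg.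
  have cxy : {within `[x, y], continuous (Wr T x0 phi1 phi2)}.
    apply: continuous_subspaceW cW => z /=; rewrite in_itv/= => /andP[xz zy].
    exact: (Iset_convex Ix Iy).
  have [|c] := @IVT _ _ _ _ 0 xy cxy.
    move: neg; set u := Wr _ _ _ _ x; set v := Wr _ _ _ _ y => neg.
    rewrite ge_min le_max; have [u0|u0] := leP u 0; have [v0|v0] := leP v 0;
      rewrite ?(ltW u0) ?(ltW v0) ?orbT//=; move: neg; rewrite ltNge.
      by rewrite mulr_le0.
    by rewrite mulr_ge0// ltW.
  rewrite in_itv/= => /andP[xc cy] Wc; have /w0/eqP := Iset_convex Ix Iy xc cy; exact.
exists (- Num.sg (Wr T x0 phi1 phi2 T)); first by rewrite normrN normr_sg w0.
move=> x Ix; rewrite dI_qE//; set W := Wr T x0 phi1 phi2 x.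
have := same _ _ IT Ix Ix.1; rewrite -/W => WW.
rewrite !normrM normfV normrN (ger0_norm (exprn_even_ge0 _ _))//.
rewrite mulrA mulrNN; congr (_ / _).
have [W0|W0|W0] := ltgtP (Wr T x0 phi1 phi2 T) 0.
- rewrite ltr0_sg// mulN1r ltr0_norm//; nra.
- rewrite gtr0_sg// mul1r gtr0_norm//; nra.
- by have := w0 IT; rewrite W0 eqxx.
Qed.

Lemma q_unbounded M : 0 < M -> exists2 c, I c & forall x, c <= x -> I x -> M <= `|q x|.
Proof.
move=> M0; have Mi : 0 < M^-1 by rewrite invr_gt0.
have /(near_at_x0P Tx0)[c Ic H] := phi21 Mi; exists c => // x cx Ix.
have := H x cx Ix; rewrite /q normrM normfV ler_pdivlMr ?normr_gt0 ?p2//.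
by rewrite ler_pdivlMl.
Qed.

(** * Expansion with a fixed leading coefficient *)

Section Coefficient.
Variable a1 : R.

Let F := fun x => fq x + - a1 * q x.
Let g := fun t => dI T x0 q t * (fs t - a1).

Lemma derivI_F x : I x -> Df x -> derivI T x0 F x (g x).
Proof.
move=> Ix dfx; rewrite /g mulrBr [_ * a1]mulrC -mulNr.
apply: derivI_lin => //; first exact: derivI_fq.
by rewrite dI_qE//; exact: derivI_q.
Qed.

Lemma abs_cont_F a b : I a -> I b -> a <= b -> abs_cont a b F.
Proof.
move=> Ia Ib ab; apply: abs_contD; last exact/abs_cont_scale/abs_cont_q.
by apply: abs_contM; [exact: fAC|exact: abs_cont_inv_phi2].
Qed.

Lemma ae_Df a b : I a -> I b -> a <= b ->
  {ae mu, forall t, a < t -> t < b -> Df t}.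
Proof.
move=> Ia Ib ab; have := abs_cont_ae_derivable ab (fAC Ia Ib ab).
apply: (@filterS _ _ lebesgue_ae_filter).
move=> t H at_ tb; have [d fd] := H at_ tb; exists d.
apply/derivI_dquot => //; first exact: le_lt_trans Ia.1 at_.
by apply: (Iset_convex Ia Ib); exact: ltW.
Qed.

(** By [dI_q_fs], [g] is at every point of the segment a polynomial in [f], [1 / phi2] and relative
    derivatives, so no exceptional set has to be removed. *)
Lemma measurable_g a b : I a -> I b -> a <= b -> measurable_fun `[a, b] g.
Proof.
move=> Ia Ib ab.
have sub : `[a, b] `<=` `[T, b].
  by move=> t; rewrite /= !in_itv/= => /andP[at_ ->]; rewrite (le_trans Ia.1).
apply: measurable_funS sub _ => //; have Tb := Ib.1.
have mc h : abs_cont T b h -> measurable_fun `[T, b] h.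
  move=> ach; apply: subspace_continuous_measurable_fun => //.
  exact: abs_cont_continuous.
have cf := within_continuous_f.
pose i2 x := (phi2 x)^-1.
apply: (eq_measurable_fun (fun t => dI T x0 f t * i2 t +
    - (f t * dI T x0 phi2 t * (i2 t * i2 t)) + - (dI T x0 q t * a1))).
  move=> t; rewrite inE/= in_itv/= => /andP[Tt tb].
  have It : I t by exact: (Iset_convex IT Ib).
  rewrite /g mulrBr dI_q_fs// /i2; field; exact: p2.
have mi2 : measurable_fun `[T, b] i2 by apply: mc; exact: abs_cont_inv_phi2.
have mf : measurable_fun `[T, b] f by apply: mc; exact: fAC.
have mdf := measurable_dI cf Ib.
have mdp := measurable_dI (derivableI_within_continuous phi2C1.1) Ib.
have mdq := measurable_dI within_continuous_q Ib.
apply: measurable_funD; first apply: measurable_funD.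
- exact: measurable_funM.
- apply: measurableT_comp => //; apply: measurable_funM; exact: measurable_funM.
- by apply: measurableT_comp => //; apply: measurable_funM.
Qed.

Lemma F_increment a b : I a -> I b -> a <= b ->
  mu.-integrable `[a, b] (EFin \o g) /\ F b - F a = \int[mu]_(t in `[a, b]) g t.
Proof.
move=> Ia Ib ab.
have [|gint gE] := abs_cont_FTC ab (abs_cont_F Ia Ib ab) (measurable_g Ia Ib ab).
  apply: (@filterS _ _ lebesgue_ae_filter _ _ _ (ae_Df Ia Ib ab)).
  move=> t H at_ tb.
  have It : I t by apply: (Iset_convex Ia Ib); exact: ltW.
  apply/(derivI_dquot F (g t) (le_lt_trans Ia.1 at_) It).
  by apply: derivI_F => //; exact: H.
by split => //; exact: gE.
Qed.

(** Because [q'] has the constant sign [s], the bound [|F'| <= e |q'|] reads [|F'| <= (e s q)']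
    almost everywhere; comparing increments of [F] with those of [e s q] and of its opposite gives
    both sides of the estimate. *)
Lemma F_increment_le c e : I c -> 0 <= e ->
  (forall t, c <= t -> I t -> Df t -> `|fs t - a1| <= e) ->
  forall x, c <= x -> I x -> `|F x - F c| <= e * `|q x - q c|.
Proof.
move=> Ic e0 H x cx Ix; have [s s1 sq] := dI_q_sign.
have acF := abs_cont_F Ic Ix cx; have acq := abs_cont_q Ic Ix cx.
have dscale k (h : R -> R) t d : dquot h t @ t^' --> d ->
    dquot (fun y => k * h y) t @ t^' --> k * d.
  move=> hd; rewrite (_ : dquot _ t = fun y => k * dquot h t y).
    by apply: cvgM => //; exact: cvg_cst.
  by apply/funext => y; rewrite /dquot; ring.
have key : {ae mu, forall t, c < t -> t < x -> [/\ `|g t| <= e * s * dI T x0 q t,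
    dquot F t @ t^' --> g t & dquot q t @ t^' --> dI T x0 q t]}.
  apply: (@filterS _ _ lebesgue_ae_filter _ _ _ (ae_Df Ic Ix cx)).
  move=> t Dft ct tx; have It : I t by apply: (Iset_convex Ic Ix); exact: ltW.
  have Tt := le_lt_trans Ic.1 ct.
  split.
  - rewrite -mulrA sq// /g normrM mulrC ler_wpM2r//.
    by apply: H => //; [exact: ltW|exact: Dft].
  - by apply/(derivI_dquot F (g t) Tt It); apply: derivI_F => //; exact: Dft.
  - by apply/(derivI_dquot q _ Tt It); rewrite dI_qE//; exact: derivI_q.
have up : F x - F c <= e * s * q x - e * s * q c.
  apply: (abs_cont_le_increment cx acF (abs_cont_scale _ acq)).
  apply: (@filterS _ _ lebesgue_ae_filter _ _ _ key).
  move=> t K ct tx; have [gle Fg qd] := K ct tx.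
  exists (g t), (e * s * dI T x0 q t); split => //; last exact: dscale.
  exact: le_trans (ler_norm _) gle.
have low : - (e * s) * q x - - (e * s) * q c <= F x - F c.
  apply: (abs_cont_le_increment cx (abs_cont_scale _ acq) acF).
  apply: (@filterS _ _ lebesgue_ae_filter _ _ _ key).
  move=> t K ct tx; have [gle Fg qd] := K ct tx.
  exists (- (e * s) * dI T x0 q t), (g t); split => //; first last.
    exact: dscale.
  by move: gle; rewrite ler_norml mulNr => /andP[].
have : `|F x - F c| <= e * s * (q x - q c).
  by rewrite ler_norml; apply/andP; split; lra.
move=> /le_trans; apply; rewrite -mulrA ler_wpM2l//.
by rewrite (le_trans (ler_norm _))// normrM s1 mul1r.
Qed.

Lemma lim_fs_iff_littleo :
  lim_on (at_x0 x0) Df fs a1 <->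
  littleo_on (at_x0 x0) Df (fun x => dI T x0 fq x - a1 * dI T x0 q x) (dI T x0 q).
Proof.
have E x : I x -> Df x ->
    `|dI T x0 fq x - a1 * dI T x0 q x| = `|fs x - a1| * `|dI T x0 q x|.
  move=> Ix dfx; rewrite (derivI_dI Ix (derivI_fq Ix dfx)) mulrC -mulrBl.
  by rewrite normrM.
split=> H e e0; apply/(near_at_x0P Tx0).
  have /(near_at_x0P Tx0)[c Ic Hc] := H e e0; exists c => // x cx Ix dfx.
  by rewrite E// ler_wpM2r// ltW// Hc.
(* Halving turns the weak inequality of the little-o into the strict one of the limit; division by
   [|q'|] is allowed as it never vanishes. *)
have e20 : 0 < e / 2 by rewrite divr_gt0.
have /(near_at_x0P Tx0)[c Ic Hc] := H _ e20; exists c => // x cx Ix dfx.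
have := Hc x cx Ix dfx; rewrite E// ler_pM2r ?normr_gt0 ?dI_q_neq0// => /le_lt_trans.
by apply; rewrite gtr_pMr// invf_lt1// ltr1n.
Qed.

Lemma f_sub_phi1 x : I x -> f x - a1 * phi1 x = phi2 x * F x.
Proof. by move=> Ix; rewrite /F /fq /q; field; exact: p2. Qed.

Lemma lim_fs_littleo_phi1 : lim_on (at_x0 x0) Df fs a1 ->
  littleo_at (at_x0 x0) (fun x => f x - a1 * phi1 x) phi1.
Proof.
move=> H e e0; apply/(near_at_x0P Tx0).
have e20 : 0 < e / 2 by rewrite divr_gt0.
have /(near_at_x0P Tx0)[c Ic Hc] := H _ e20.
have {}Hc t : c <= t -> I t -> Df t -> `|fs t - a1| <= e / 2.
  by move=> ct It dft; rewrite ltW// Hc.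
(* [|F x|] is at most [K + e / 2 * |q x|], and the fixed [K] is absorbed by a second [e / 2 * |q x|]
   once [|q|] is large. Below, [K + 1] provides the positive bound that [q_unbounded] asks for. *)
pose K := `|F c| + e / 2 * `|q c|.
have K0 : 0 <= K by rewrite addr_ge0// mulr_ge0// ltW.
have [|d Id Hd] := @q_unbounded ((K + 1) / (e / 2)); first by rewrite divr_gt0// ltr_wpDl.
exists (Num.max c d); first exact: Iset_max.
move=> x; rewrite ge_max => /andP[cx dx] Ix.
have := Hd x dx Ix; rewrite ler_pdivrMr// mulrC => qx.
have Fx := F_increment_le Ic (ltW e20) Hc cx Ix.
have : `|F x| <= e * `|q x|.
  have h1 : `|F x| <= `|F c| + `|F x - F c|.
    by rewrite -{1}(subrK (F c) (F x)) addrC ler_normD.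
  have h2 : e / 2 * `|q x - q c| <= e / 2 * `|q x| + e / 2 * `|q c|.
    by rewrite -mulrDr ler_wpM2l ?(ltW e20)// ler_normB.
  rewrite /K in qx; move: qx h1 h2 Fx.
  rewrite [in X in _ -> _ -> _ -> _ -> _ <= X](splitr e) mulrDl.
  lra.
rewrite f_sub_phi1// => Fq; rewrite (_ : phi1 x = phi2 x * q x).
  by rewrite !(normrM (phi2 x)) mulrCA ler_wpM2l.
by rewrite mulrC divfK// p2.
Qed.

(** The remainder is [phi2 * (F - a2)], and [phi2] has no zeros. *)
Lemma littleo_phi2P a2 :
  littleo_at (at_x0 x0) (fun x => f x - a1 * phi1 x - a2 * phi2 x) phi2 <->
  F @ at_x0 x0 --> a2.
Proof.
have E x : I x -> `|f x - a1 * phi1 x - a2 * phi2 x| = `|a2 - F x| * `|phi2 x|.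
  move=> Ix; rewrite f_sub_phi1// [phi2 x * _]mulrC -mulrBl normrM distrC //.
split=> [H|/(cvg_at_x0P Tx0) H].
  apply/(cvg_at_x0P Tx0) => e e0; have e20 : 0 < e / 2 by rewrite divr_gt0.
  have /(near_at_x0P Tx0)[c Ic Hc] := H _ e20; exists c => // x cx Ix.
  have := Hc x cx Ix; rewrite E// ler_pM2r ?normr_gt0 ?p2// => /le_lt_trans.
  by apply; rewrite gtr_pMr// invf_lt1// ltr1n.
move=> e e0; apply/(near_at_x0P Tx0); have [c Ic Hc] := H e e0.
by exists c => // x cx Ix; rewrite E// ler_wpM2r// ltW// Hc.
Qed.

Lemma improper_convP :
  improper_conv T x0 g <-> exists a2 : R, F @ at_x0 x0 --> a2.
Proof.
have inc x : I x -> \int[mu]_(t in `[T, x]) g t = F x - F T.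
  by move=> Ix; have [_ ->] := F_increment IT Ix Ix.1.
split=> [[_ [l /(cvg_at_x0P Tx0) H]]|[a2 /(cvg_at_x0P Tx0) H]].
  (* The integral over [[T, x]] is [F x - F T], so the two limits differ by [F T]. *)
  exists (l + F T); apply/(cvg_at_x0P Tx0) => e e0.
  have [c Ic Hc] := H e e0; exists c => // x cx Ix.
  by have := Hc x cx Ix; rewrite inc// opprB addrA addrAC.
split; first by move=> x Ix; have [] := F_increment IT Ix Ix.1.
exists (a2 - F T); apply/(cvg_at_x0P Tx0) => e e0.
have [c Ic Hc] := H e e0; exists c => // x cx Ix; rewrite inc//.
by rewrite opprB addrA subrK Hc.
Qed.

Lemma tail_integral_F a2 x : F @ at_x0 x0 --> a2 -> I x ->
  tail_integral x0 g x (a2 - F x).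
Proof.
move=> /(cvg_at_x0P Tx0) H Ix; apply/(cvg_at_x0P Tx0) => e e0.
have [c Ic Hc] := H e e0; exists (Num.max c x); first exact: Iset_max.
move=> y; rewrite ge_max => /andP[cy xy] Iy.
have [_ <-] := F_increment Ix Iy xy.
by rewrite opprB addrA subrK Hc.
Qed.

End Coefficient.
End TwoTermExpansion.

Theorem theorem4p3 (R : realType) (x0 : \bar R) (T : R)
  (phi1 phi2 f : R -> R) :
  (T%:E < x0)%E ->
  C1I T x0 phi1 -> C1I T x0 phi2 ->
  littleo_at (at_x0 x0) phi2 phi1 ->
  (forall x, Iset T x0 x -> phi1 x <> 0) ->
  (forall x, Iset T x0 x -> phi2 x <> 0) ->
  (forall x, Iset T x0 x -> Wr T x0 phi1 phi2 x <> 0) ->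
  ACI T x0 f ->
  let q := fun x => phi1 x / phi2 x in
  let fq := fun x => f x / phi2 x in
  let Df := derivableI T x0 f in
  let fs := f1star T x0 phi1 phi2 f in
  (* the derivative identity (f/phi2)' = (phi1/phi2)' f_1^* *)
  (forall x, Iset T x0 x -> Df x -> derivI T x0 fq x (dI T x0 q x * fs x)) /\
  (* (I) *)
  (forall a1 : R,
    let ci := lim_on (at_x0 x0) Df fs a1 in
    let cii := littleo_on (at_x0 x0) Df
                 (fun x => dI T x0 fq x - a1 * dI T x0 q x) (dI T x0 q) in
    let ciii := littleo_at (at_x0 x0) (fun x => f x - a1 * phi1 x) phi1 /\ cii in
    (ci <-> cii) /\ (ci <-> ciii)) /\
  (* (II) *)
  (forall a1 : R,
    let g := fun t => dI T x0 q t * (fs t - a1) in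
    let cond := lim_on (at_x0 x0) Df fs a1 /\ improper_conv T x0 g in
    let asym := fun a2 : R =>
      littleo_at (at_x0 x0) (fun x => f x - a1 * phi1 x - a2 * phi2 x) phi2 /\
      littleo_on (at_x0 x0) Df
        (fun x => dI T x0 fq x - a1 * dI T x0 q x) (dI T x0 q) in
    (cond <-> exists a2 : R, asym a2) /\
    (forall a2 : R, cond -> asym a2 ->
       forall x, Iset T x0 x -> exists J : R,
         tail_integral x0 g x J /\
         f x = a1 * phi1 x + a2 * phi2 x - phi2 x * J)).

Proof.
move=> Tx0 C1 C2 o21 _ n2 nW acf q fq Df fs; split; last split.
- by move=> x Ix dfx; exact: derivI_fq.
- move=> a1 ci cii ciii.
  have ciE : ci <-> cii by exact: lim_fs_iff_littleo.
  split; first exact: ciE.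
  split=> [h|[_ /ciE h]]; last exact: h.
  by split; [exact: (lim_fs_littleo_phi1 Tx0 C1 C2 o21 n2 nW acf h)|exact/ciE].
- move=> a1 g cond asym.
  have ciE : lim_on (at_x0 x0) Df fs a1 <-> littleo_on (at_x0 x0) Df
      (fun x => dI T x0 fq x - a1 * dI T x0 q x) (dI T x0 q).
    exact: lim_fs_iff_littleo.
  have aP a2 := littleo_phi2P phi1 f Tx0 n2 a1 a2.
  have iP := improper_convP Tx0 C1 C2 n2 nW acf a1.
  split; [split=> [[ci /iP[a2 Fa2]]|[a2 [/aP Fa2 /ciE ci]]]|].
  + by exists a2; split; [exact/aP|exact/ciE].
  + by split=> //; apply/iP; exists a2.
  (* The tail integral from [x] is the limit [a2] of [F] minus [F x]; solving this for [f x] gives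
     the formula. *)
  + move=> a2 _ [/aP Fa2 _] x Ix; exists (a2 - (fq x + - a1 * q x)); split.
      exact: (tail_integral_F Tx0 C1 C2 n2 nW acf Fa2 Ix).
    by rewrite /fq /q; field; apply/eqP; exact: n2.
Qed.
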